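(* Let $n\ge 1$, let $A=\operatorname{Diag}(a_1I_{m_1},\dots,a_sI_{m_s})$ and $B=\operatorname{Diag}(b_1I_{n_1},\dots,b_tI_{n_t})$ be real $n\times n$ matrices with $a_1<\cdots<a_s$, $b_1<\cdots<b_t$, $m_i,n_j\ge1$ and $\sum_im_i=\sum_jn_j=n$. Let $f:O(n)\to\mathbb{R}$, $f(X)=\operatorname{Tr}(AXBX^T)$. Let $X=SP_\sigma$ be a signed permutation matrix. Then: (1) $X$ is a critical point of $f$. (2) If $\epsilon_{ij}$ denotes the number of non-zero entries in the $m_i\times n_j$ block $X[i,j]$ of $X$, then $\epsilon=(\epsilon_{ij})$ is a perfect filling and there are $Q\in O(\overline{m})$, $R\in O(\overline{n})$ such that $X=\Phi_\epsilon(Q,R)$. (One can even arrange that the $Q[i]$ are signed permutation matrices and the $R[j]$ are permutation matrices.) (3) The Hessian $H=H(f,X)$ of $f$ at $X$, viewed as a quadratic form on $\mathfrak{so}(n)$, is diagonal in the standard basis $\{\mathbb{E}(p,q)\}_{1\le p<q\le n}$ of $\mathfrak{so}(n)$, and the numbers $H(p,q):=H(\mathbb{E}(p,q),\mathbb{E}(p,q))$ (for $1\le p<q\le n$) are given by $$H(p,q)=2(B_{pp}-B_{qq})(A_{\sigma(q)\sigma(q)}-A_{\sigma(p)\sigma(p)}).$$ (4) The index of $H=H(f,X)$ is equal to the number of $(p,q)\in\{1,\dots,n\}^2$ with $B_{pp}<B_{qq}$ and $A_{\sigma(q)\sigma(q)}>A_{\sigma(p)\sigma(p)}$. In terms of the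 perfect filling $\epsilon$ associated to $X$ in (2), this index can be written $$\sum_{(i,j)<(k,l)}\epsilon_{ij}\epsilon_{kl},$$ where $(i,j)<(k,l)$ means $i<k$ and $j<l$.
   Context: $\operatorname{Diag}$ denotes a (block-)diagonal matrix. For $\sigma$ in the symmetric group $\mathfrak{S}_n$, $P_\sigma$ is the $n\times n$ matrix whose $i$-th column is column $\sigma(i)$ of the identity matrix. A sign matrix is a diagonal matrix with diagonal entries in $\{\pm1\}$; a signed permutation matrix is a matrix $SP_\sigma$ with $S$ a sign matrix and $\sigma\in\mathfrak{S}_n$. $\mathfrak{so}(n)$ is the space of skew-symmetric real $n\times n$ matrices; for $1\le p<q\le n$, $\mathbb{E}(p,q)\in\mathfrak{so}(n)$ has $(p,q)$ entry $-1$, $(q,p)$ entry $1$, and all other entries $0$. The Hessian of $f$ at a critical point $X$ (the symmetric bilinear form on $T_XO(n)$ given by the second derivative of $f$) is viewed as a form on $\mathfrak{so}(n)$ via the isomorphism $\mathfrak{so}(n)\to T_XO(n)$, $E\mapsto XE$. Its index is the maximal dimension of a subspace on which it is negative definite. The $n\times n$ matrix $X$ is cut into blocks $X[i,j]$ ($1\le i\le s$, $1\le j\le t$) of size $m_i\times n_j$, according to the row partition $(m_1,\dots,m_s)$ and column partition $(n_1,\dots,n_t)$. A perfect filling is an $s\times t$ matrix $\epsilon=(\epsilon_{ij})$ with entries in $\{0,1,2,\dots\}$ such that $\sum_{j}\epsilon_{ij}=m_i$ for each $i$ and $\sum_i\epsilon_{ij}=n_j$ for each $j$. Set $O(\overline{m})=\prod_{i=1}^sO(m_i)$,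 $O(\overline{n})=\prod_{j=1}^tO(n_j)$. Given $Q=(Q[1],\dots,Q[s])\in O(\overline{m})$, $R=(R[1],\dots,R[t])\in O(\overline{n})$ and a perfect filling $\epsilon$, write $Q[i]=(Q[i,1]\ \cdots\ Q[i,t])$ with $Q[i,j]$ of size $m_i\times\epsilon_{ij}$ and $R[j]=(R[1,j]\ \cdots\ R[s,j])$ with $R[i,j]$ of size $n_j\times\epsilon_{ij}$. Then $\Phi_\epsilon(Q,R)$ is the $n\times n$ matrix whose $(i,j)$ block is the $m_i\times n_j$ matrix $Q[i,j]R[i,j]^T$. *)

(* Defs.v *)
From HB Require Import structures.
From mathcomp Require Import all_boot all_order all_algebra all_fingroup.
From mathcomp Require Import all_classical all_reals all_analysis.

Set Implicit Arguments.
Unset Strict Implicit.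
Unset Printing Implicit Defensive.

Import Order.TTheory GRing.Theory Num.Theory.
Import numFieldNormedType.Exports.

Local Open Scope ring_scope.

Definition orthogonal_mx (R : realType) n (X : 'M[R]_n) : Prop :=
  X^T *m X = 1%:M.

(* Column [j] is column [sigma j] of the identity; this is the transpose of
   MathComp's [perm_mx sigma]. *)
Definition P_mx (R : realType) n (sigma : 'S_n) : 'M[R]_n :=
  col_perm sigma 1%:M.

Definition sign_mx (R : realType) n (S : 'M[R]_n) : Prop :=
  is_diag_mx S /\ forall i, S i i = 1 \/ S i i = -1.

Definition signed_perm_mx (R : realType) n (X : 'M[R]_n) : Prop :=
  exists S : 'M[R]_n, exists sigma : 'S_n,
    sign_mx S /\ X = S *m P_mx R sigma.

(* A function on O(n) is represented by a function on all matrices of which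
   only the values on O(n) are used. *)

Definition Ck_curve (R : realType) n (k : nat) (X : 'M[R]_n)
    (g : R -> 'M[R]_n) : Prop :=
  [/\ forall t, orthogonal_mx (g t),
      g 0 = X,
      forall j t, (j < k)%N -> derivable (g^`(j))%classic t 1
    & continuous (g^`(k))%classic].

Definition critical_point (R : realType) n (f : 'M[R]_n -> R)
    (X : 'M[R]_n) : Prop :=
  orthogonal_mx X /\
  forall g, Ck_curve 1 X g -> is_derive (0 : R) 1 (f \o g) 0.

Definition so_mx (R : realType) n (E : 'M[R]_n) : Prop := E^T = - E.

Definition E_mx (R : realType) n (p q : 'I_n) : 'M[R]_n :=
  delta_mx q p - delta_mx p q.

Definition sym_bilinear_on_so (R : realType) n
    (H : 'M[R]_n -> 'M[R]_n -> R) : Prop :=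
  (forall E F, so_mx E -> so_mx F -> H E F = H F E) /\
  (forall c E F G, so_mx E -> so_mx F -> so_mx G ->
     H (c *: E + F) G = c * H E G + H F G).

(* At a critical point X of f, the second derivative at 0 of [f \o g] depends
   only on the tangent vector [g^`() 0 = X *m E], and is the value at E of the
   Hessian pulled back to so(n) along [E |-> X *m E].  Since every tangent
   vector of O(n) is the velocity of a C^2 curve, this determines [H] on so(n);
   at a non-critical point there is in general no such [H]. *)
Definition hessian (R : realType) n (f : 'M[R]_n -> R) (X : 'M[R]_n)
    (H : 'M[R]_n -> 'M[R]_n -> R) : Prop :=
  sym_bilinear_on_so H /\
  forall g E, Ck_curve 2 X g -> so_mx E -> (g^`())%classic 0 = X *m E ->
    (\forall t \near (0 : R), derivable (f \o g) t 1)%classic /\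
    is_derive (0 : R) 1 ((f \o g)^`())%classic (H E E).

Definition neg_def_on (R : realType) n (H : 'M[R]_n -> 'M[R]_n -> R)
    (V : {vspace 'M[R]_n}) : Prop :=
  forall E, E \in V -> E != 0 -> H E E < 0.

Definition so_subspace (R : realType) n (V : {vspace 'M[R]_n}) : Prop :=
  forall E, E \in V -> so_mx E.

Definition has_index (R : realType) n (H : 'M[R]_n -> 'M[R]_n -> R)
    (k : nat) : Prop :=
  (exists V : {vspace 'M[R]_n},
     [/\ so_subspace V, neg_def_on H V & \dim V = k]) /\
  (forall V : {vspace 'M[R]_n},
     so_subspace V -> neg_def_on H V -> (\dim V <= k)%N).

Definition block_scalar (R : realType) n s (m : 'I_s -> nat)
    (hm : (\sum_i m i)%N = n) (a : 'I_s -> R) : 'M[R]_n :=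
  castmx (hm, hm) (\mxdiag_(i < s) ((a i)%:M : 'M[R]_(m i))).

Definition block (R : realType) n s t (m : 'I_s -> nat) (nn : 'I_t -> nat)
    (hm : (\sum_i m i)%N = n) (hn : (\sum_j nn j)%N = n) (X : 'M[R]_n)
    (i : 'I_s) (j : 'I_t) : 'M[R]_(m i, nn j) :=
  submxblock (castmx (esym hm, esym hn) X) i j.

Definition nonzero_count (R : realType) n s t
    (m : 'I_s -> nat) (nn : 'I_t -> nat)
    (hm : (\sum_i m i)%N = n) (hn : (\sum_j nn j)%N = n)
    (X : 'M[R]_n) : 'M[nat]_(s, t) :=
  \matrix_(i, j)
    #|[pred uv : 'I_(m i) * 'I_(nn j) | block hm hn X i j uv.1 uv.2 != 0]|.

Definition perfect_filling s t (m : 'I_s -> nat) (nn : 'I_t -> nat)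
    (eps : 'M[nat]_(s, t)) : Prop :=
  (forall i, (\sum_j eps i j)%N = m i) /\
  (forall j, (\sum_i eps i j)%N = nn j).

(* The proof of [perfect_filling] serves only to retype [Q i] and [R j] as
   rows of blocks of widths [eps i j]. *)
Definition Phi (K : realType) n s t (m : 'I_s -> nat) (nn : 'I_t -> nat)
    (hm : (\sum_i m i)%N = n) (hn : (\sum_j nn j)%N = n)
    (eps : 'M[nat]_(s, t)) (h : perfect_filling m nn eps)
    (Q : forall i, 'M[K]_(m i)) (R : forall j, 'M[K]_(nn j)) : 'M[K]_n :=
  let Qb i j : 'M[K]_(m i, eps i j) :=
    submxrow (q_ := fun j' => eps i j')
      (castmx (erefl, esym (h.1 i)) (Q i)) j in
  let Rb i j : 'M[K]_(nn j, eps i j) :=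
    submxrow (q_ := fun i' => eps i' j)
      (castmx (erefl, esym (h.2 j)) (R j)) i in
  castmx (hm, hn) (\mxblock_(i < s, j < t) (Qb i j *m (Rb i j)^T)).

(* Main.v *)
(* With A = diag(alpha) and B = diag(beta), f(X) is the sum of
   alpha_i beta_k X_ik^2, so along a curve g in O(n) its derivatives are those of
   the squared entries.  At a signed permutation matrix X column k is
   +-e_(sigma k), and the first two derivatives of |g e_k|^2 = 1 determine
   g'_(sigma k, k) = 0 and X_(sigma k, k) g''_(sigma k, k) = - |g' e_k|^2.
   Hence X is critical and (f o g)'' depends only on g'(0) = X E, through the
   form with coefficients (beta_p - beta_q) (alpha_(sigma q) - alpha_(sigma p)) on
   the squares E_pq^2.  Every E in so(n) is attained, by the Cayley curve
   X (1 - t E / 2)^-1 (1 + t E / 2), so polarization determines the Hessian, and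
   the index of a diagonal form is its number of negative coefficients.

   For the filling, if (u, v) is the k-th nonzero position of block (i, j), the
   k-th column of Q[i, j] is +-e_u and that of R[i, j] is e_v. *)
Require Import Defs.
From HB Require Import structures.
From mathcomp Require Import all_boot all_order all_algebra all_fingroup.
From mathcomp Require Import all_classical all_reals all_analysis.
From mathcomp Require Import ring.
Import Order.TTheory GRing.Theory Num.Theory.
Import numFieldNormedType.Exports.
Local Open Scope ring_scope.

Set Implicit Arguments.
Unset Strict Implicit.
Unset Printing Implicit Defensive.

(** * Derivatives along curves in O(n) *)

Lemma is_derive_fsum (K : realType) n (h : 'I_n -> K -> K) (dh : 'I_n -> K) (t : K) :
  (forall i, is_derive t 1 (h i) (dh i)) ->
  is_derive t 1 (fun x => \sum_i h i x) (\sum_i dh i).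
Proof.
move=> dhP.
have -> : (fun x => \sum_i h i x) = \sum_i h i; last exact: is_derive_sum.
by apply/funext => x; rewrite fct_sumE.
Qed.

Lemma is_derive_entry (K : realType) m n (g : K -> 'M[K]_(m, n)) (t : K) i j :
  derivable g t 1 ->
  is_derive t 1 (fun x => g x i j) ((g^`())%classic t i j).
Proof.
move=> gt; have /derivable_mxP gij := gt.
apply: DeriveDef; first exact: gij.
by rewrite derive1E derive_mx// mxE.
Qed.

Lemma Ck_curve_is_derive (K : realType) n k (X : 'M[K]_n) g j (t : K) a b :
  Ck_curve k X g -> (j < k)%N ->
  is_derive t 1 (fun x => (g^`(j))%classic x a b) ((g^`(j.+1))%classic t a b).
Proof. by case=> _ _ dg _ jk; rewrite derive1nS; apply/is_derive_entry/dg. Qed.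

Lemma is_derive_sqr (K : realType) (f : K -> K) (t df : K) :
  is_derive t 1 f df -> is_derive t 1 (fun x => f x ^+ 2) (2 * f t * df).
Proof.
move=> dff; have -> : (fun x => f x ^+ 2) = f ^+ 2 by rewrite exprfctE.
by have := @is_deriveX _ _ f 2 t 1 df dff; rewrite expr1.
Qed.

Lemma is_derive_mul (K : realType) (f g : K -> K) (t df dg : K) :
  is_derive t 1 f df -> is_derive t 1 g dg ->
  is_derive t 1 (fun x => f x * g x) (f t * dg + g t * df).
Proof. by move=> dff dgg; exact: (@is_deriveM _ _ f g t 1 df dg). Qed.

Lemma orthogonal_col_sqr (K : realType) n (X : 'M[K]_n) k :
  orthogonal_mx X -> \sum_i X i k ^+ 2 = 1.
Proof.
move=> /matrixP/(_ k k); rewrite !mxE eqxx mulr1n => <-.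
by apply: eq_bigr => i _; rewrite mxE.
Qed.

Lemma Ck_curve_col1 (K : realType) n k (X : 'M[K]_n) g (t : K) c :
  Ck_curve k X g -> (0 < k)%N ->
  \sum_i g t i c * (g^`())%classic t i c = 0.
Proof.
move=> gP k0; have [og _ _ _] := gP.
have dg : is_derive t 1 (fun x => \sum_i g x i c ^+ 2)
    (\sum_i 2 * g t i c * (g^`())%classic t i c).
  apply: is_derive_fsum => i; apply: is_derive_sqr.
  exact: (Ck_curve_is_derive (j := 0) _ _ _ gP k0).
have d0 : is_derive t 1 (fun x => \sum_i g x i c ^+ 2) 0.
  rewrite (_ : (fun _ => _) = cst 1); first exact: is_derive_cst.
  by apply/funext => x; rewrite (@orthogonal_col_sqr _ _ (g x)).
have := @derive_val _ _ _ _ _ _ _ dg; rewrite (@derive_val _ _ _ _ _ _ _ d0) => e.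
have two0 : (2 : K) != 0 by rewrite pnatr_eq0.
apply: (mulfI two0); rewrite mulr0 [RHS]e mulr_sumr.
by apply: eq_bigr => i _; rewrite mulrA.
Qed.

(** Differentiates the identity of [Ck_curve_col1] once more, which is why that identity is proved
    at every [t] and not only at [0]. *)
Lemma Ck_curve_col2 (K : realType) n k (X : 'M[K]_n) g (t : K) c :
  Ck_curve k X g -> (1 < k)%N ->
  \sum_i g t i c * (g^`(2))%classic t i c =
  - \sum_i (g^`())%classic t i c ^+ 2.
Proof.
move=> gP k1.
have dg : is_derive t 1 (fun x => \sum_i g x i c * (g^`())%classic x i c)
    (\sum_i (g t i c * (g^`(2))%classic t i c +
             (g^`())%classic t i c * (g^`())%classic t i c)).
  apply: is_derive_fsum => i; apply: is_derive_mul.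
    exact: (Ck_curve_is_derive (j := 0) _ _ _ gP (ltnW k1)).
  exact: (Ck_curve_is_derive (j := 1) _ _ _ gP k1).
have d0 : is_derive t 1 (fun x => \sum_i g x i c * (g^`())%classic x i c) 0.
  rewrite (_ : (fun _ => _) = cst 0); first exact: is_derive_cst.
  by apply/funext => x; rewrite (Ck_curve_col1 _ _ gP (ltnW k1)).
have := @derive_val _ _ _ _ _ _ _ dg; rewrite (@derive_val _ _ _ _ _ _ _ d0) => e.
by apply/eqP; rewrite -addr_eq0 -big_split/=; apply/eqP; rewrite [RHS]e.
Qed.

(** * The trace function and its first two derivatives *)

Definition trace_fun (K : realType) n (alpha beta : 'rV[K]_n) (Y : 'M[K]_n) : K :=
  \tr (diag_mx alpha *m Y *m diag_mx beta *m Y^T).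

Lemma trace_funE (K : realType) n (alpha beta : 'rV[K]_n) Y :
  trace_fun alpha beta Y =
  \sum_i \sum_k alpha 0 i * beta 0 k * Y i k ^+ 2.
Proof.
apply: eq_bigr => i _; rewrite mxE; apply: eq_bigr => k _.
by rewrite mul_diag_mx mul_mx_diag !mxE; ring.
Qed.

Lemma is_derive_trace_fun (K : realType) n (alpha beta : 'rV[K]_n) k X g (t : K) :
  Ck_curve k X g -> (0 < k)%N ->
  is_derive t 1 (trace_fun alpha beta \o g)
    (\sum_i \sum_l alpha 0 i * beta 0 l * (2 * g t i l * (g^`())%classic t i l)).
Proof.
move=> gP k0; have -> : trace_fun alpha beta \o g =
    fun x => \sum_i \sum_l alpha 0 i * beta 0 l * g x i l ^+ 2.
  by apply/funext => x; rewrite /= trace_funE.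
apply: is_derive_fsum => i; apply: is_derive_fsum => l.
have := is_deriveZ (alpha 0 i * beta 0 l) (is_derive_sqr
  (Ck_curve_is_derive (j := 0) t i l gP k0)).
exact.
Qed.

Lemma derive1_trace_fun (K : realType) n (alpha beta : 'rV[K]_n) k X g :
  Ck_curve k X g -> (0 < k)%N ->
  (trace_fun alpha beta \o g)^`()%classic =
  fun t => \sum_i \sum_l alpha 0 i * beta 0 l * (2 * g t i l * (g^`())%classic t i l).
Proof.
move=> gP k0; apply/funext => t; rewrite derive1E.
exact: (@derive_val _ _ _ _ _ _ _ (is_derive_trace_fun alpha beta t gP k0)).
Qed.

Lemma is_derive2_trace_fun (K : realType) n (alpha beta : 'rV[K]_n) k X g (t : K) :
  Ck_curve k X g -> (1 < k)%N ->
  is_derive t 1 ((trace_fun alpha beta \o g)^`())%classic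
    (\sum_i \sum_l alpha 0 i * beta 0 l *
      (2 * ((g^`())%classic t i l ^+ 2 + g t i l * (g^`(2))%classic t i l))).
Proof.
move=> gP k1; rewrite (derive1_trace_fun _ _ gP (ltnW k1)).
apply: is_derive_fsum => i; apply: is_derive_fsum => l.
(* The factor 2 goes into the scalar, leaving the product of [g] and its first derivative to be
   differentiated. *)
have := is_deriveZ (alpha 0 i * beta 0 l * 2) (is_derive_mul
  (Ck_curve_is_derive (j := 0) t i l gP (ltnW k1))
  (Ck_curve_is_derive (j := 1) t i l gP k1)).
rewrite (_ : _ \*: _ = fun x =>
  alpha 0 i * beta 0 l * (2 * g x i l * (g^`())%classic x i l)); last first.
  by apply/funext => x; rewrite /= /GRing.scale/=; ring.
rewrite (_ : _ *: _ = alpha 0 i * beta 0 l *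
   (2 * ((g^`())%classic t i l ^+ 2 + g t i l * (g^`(2))%classic t i l)))//.
by rewrite /GRing.scale/=; ring.
Qed.

(** * Criticality and the Hessian at a signed permutation matrix *)

Section SignedPermutation.
Context (K : realType) (n : nat) (S : 'M[K]_n) (sigma : 'S_n).
Hypothesis hS : sign_mx S.
Local Notation X := (S *m P_mx K sigma).

Lemma sign_mx_sqr i : S i i ^+ 2 = 1.
Proof. by case: hS => _ /(_ i)[->|->]; rewrite ?sqrrN expr1n. Qed.

Lemma sign_mx_neq0 i : S i i != 0.
Proof. by rewrite -sqrf_eq0 sign_mx_sqr oner_eq0. Qed.

Lemma signed_permE i j : X i j = S i i * (i == sigma j)%:R.
Proof.
case: hS => /is_diag_mxP Sd _.
rewrite mxE (bigD1 i)//= big1 ?addr0 ?mxE// => k ki.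
by rewrite Sd ?mul0r// eq_sym.
Qed.

Lemma mul_signed_perm (E : 'M[K]_n) i j :
  (X *m E) (sigma i) j = S (sigma i) (sigma i) * E i j.
Proof.
rewrite mxE (bigD1 i)//= big1 ?addr0 => [|k ki].
  by rewrite signed_permE eqxx mulr1.
by rewrite signed_permE (inj_eq perm_inj) eq_sym (negbTE ki) mulr0 mul0r.
Qed.

Lemma orthogonal_signed_perm : orthogonal_mx X.
Proof.
apply/matrixP => i j; rewrite !mxE (bigD1 (sigma i))//= big1 ?addr0 => [|k ki].
  rewrite mxE !signed_permE eqxx mulr1 (inj_eq perm_inj) mulrA.
  by rewrite -expr2 sign_mx_sqr mul1r.
by rewrite mxE signed_permE (negbTE ki) mulr0 mul0r.
Qed.

Lemma signed_perm_col (v : 'I_n -> K) k :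
  \sum_i X i k * v i = X (sigma k) k * v (sigma k).
Proof.
rewrite (bigD1 (sigma k))//= big1 ?addr0// => i ik.
by rewrite signed_permE (negbTE ik) mulr0 mul0r.
Qed.

(** Column [k] of [X] lives in row [sigma k], so the weight [alpha 0 i] can be frozen at [sigma k]
    and pulled out. What remains is an inner product of columns, the quantity that [Ck_curve_col1]
    and [Ck_curve_col2] evaluate. *)
Lemma signed_perm_sum (alpha : 'rV[K]_n) (beta : 'rV[K]_n) (Z : 'M[K]_n) :
  \sum_i \sum_k alpha 0 i * beta 0 k * (X i k * Z i k) =
  \sum_k alpha 0 (sigma k) * beta 0 k * \sum_i X i k * Z i k.
Proof.
rewrite exchange_big; apply: eq_bigr => k _; rewrite signed_perm_col.
rewrite (bigD1 (sigma k))//= big1 ?addr0// => i ik.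
by rewrite signed_permE (negbTE ik) mulr0 mul0r mulr0.
Qed.

Lemma critical_signed_perm (alpha beta : 'rV[K]_n) :
  critical_point (trace_fun alpha beta) X.
Proof.
split; first exact: orthogonal_signed_perm.
move=> g gP; have [_ g0 _ _] := gP.
have := is_derive_trace_fun alpha beta 0 gP isT; rewrite g0.
set G := (g^`())%classic 0.
have -> : \sum_i \sum_l alpha 0 i * beta 0 l * (2 * X i l * G i l) =
   2 * \sum_i \sum_k alpha 0 i * beta 0 k * (X i k * G i k).
  rewrite mulr_sumr; apply: eq_bigr => i _; rewrite mulr_sumr.
  by apply: eq_bigr => l _; ring.
rewrite signed_perm_sum big1 ?mulr0// => k _.
by have := Ck_curve_col1 0 k gP isT; rewrite g0 => ->; rewrite mulr0.
Qed.

(** The sum runs over ordered pairs: for skew-symmetric [E] and [F] the terms at [(p, q)] and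
    [(q, p)] agree, whence the factor 2 in the values on the standard basis. *)
Definition diag_hessian (alpha beta : 'rV[K]_n) (E F : 'M[K]_n) : K :=
  \sum_p \sum_q E p q * F p q *
    ((beta 0 p - beta 0 q) * (alpha 0 (sigma q) - alpha 0 (sigma p))).

Lemma hessian_signed_perm (alpha beta : 'rV[K]_n) :
  hessian (trace_fun alpha beta) X (diag_hessian alpha beta).
Proof.
split; [split|].
- move=> E F _ _; apply: eq_bigr => p _; apply: eq_bigr => q _.
  by rewrite (mulrC (E p q)).
- move=> c E F G _ _ _; rewrite mulr_sumr -big_split/=; apply: eq_bigr => p _.
  rewrite mulr_sumr -big_split/=; apply: eq_bigr => q _.
  by rewrite !mxE; ring.
move=> g E gP so g0'; have [_ g0 _ _] := gP; split.
  near=> t.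
  exact: (@ex_derive _ _ _ _ _ _ _ (is_derive_trace_fun alpha beta t gP isT)).
have := is_derive2_trace_fun alpha beta 0 gP isT; rewrite g0 g0'.
set G2 := (g^`(2))%classic 0; set G := X *m E.
suff -> : \sum_i \sum_l alpha 0 i * beta 0 l * (2 * (G i l ^+ 2 + X i l * G2 i l)) =
   diag_hessian alpha beta E E by [].
transitivity (2 * (\sum_i \sum_k alpha 0 i * beta 0 k * G i k ^+ 2 +
   \sum_i \sum_k alpha 0 i * beta 0 k * (X i k * G2 i k))).
  rewrite -big_split mulr_sumr; apply: eq_bigr => i _ /=.
  by rewrite -big_split mulr_sumr; apply: eq_bigr => k _ /=; ring.
rewrite signed_perm_sum.
(* The second derivative of the curve enters only through its inner products with the columns of
   [X], and these are minus the squared norms of the columns of [G]. *)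
under [X in _ + X]eq_bigr => k _.
  have := Ck_curve_col2 0 k gP isT; rewrite g0 g0' => ->.
  rewrite -sumrN mulr_sumr; over.
rewrite exchange_big/= -big_split/=.
(* Row [sigma l] of [X *m E] is row [l] of [E] up to sign, so relabelling the rows by [sigma]
   removes [X] from the sum. *)
have Gsq k l : G (sigma l) k ^+ 2 = E l k ^+ 2.
  by rewrite /G mul_signed_perm exprMn sign_mx_sqr mul1r.
transitivity (2 * \sum_k \sum_l
    (alpha 0 (sigma l) - alpha 0 (sigma k)) * beta 0 k * E l k ^+ 2).
  congr (_ * _); apply: eq_bigr => k _; rewrite -big_split/=.
  rewrite (reindex_inj (@perm_inj _ sigma))/=; apply: eq_bigr => l _.
  by rewrite Gsq; ring.
(* One of the two copies is transposed; since [E q p ^+ 2 = E p q ^+ 2], the coefficients at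
   [(p, q)] then add up to a product of two differences. *)
rewrite mulrDl mul1r {1}exchange_big/= /diag_hessian -big_split/=.
apply: eq_bigr => p _; rewrite -big_split/=; apply: eq_bigr => q _.
have -> : E q p = - E p q by have /matrixP/(_ p q) := so; rewrite !mxE.
by ring.
Unshelve. all: by end_near. Qed.

End SignedPermutation.

Lemma signed_perm_orthogonal (K : realType) n (Y : 'M[K]_n) :
  signed_perm_mx Y -> orthogonal_mx Y.
Proof. by move=> [T [tau [hT ->]]]; exact: orthogonal_signed_perm. Qed.

(** * Matrix curves with rational entries *)

Definition rational_curve (K : realType) n (q : {poly K}) (G : 'M[{poly K}]_n)
    (t : K) : 'M[K]_n :=
  q.[t]^-1 *: map_mx (horner_eval t) G.

Lemma rational_curveE (K : realType) n (q : {poly K}) (G : 'M[{poly K}]_n) t i j :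
  rational_curve q G t i j = q.[t]^-1 * (G i j).[t].
Proof. by rewrite !mxE. Qed.

Section RationalCurve.
Context (K : realType) (n : nat).

Lemma is_derive_rational_entry (q p : {poly K}) (t : K) : q.[t] != 0 ->
  is_derive t 1 (fun x => q.[x]^-1 * p.[x])
    ((q ^+ 2).[t]^-1 * (q * p^`() - q^`() * p).[t]).
Proof.
move=> qt.
have := is_derive_mul (is_deriveV qt (is_derive_poly q t)) (is_derive_poly p t).
rewrite (_ : _ + _ = (q ^+ 2).[t]^-1 * (q * p^`() - q^`() * p).[t])//.
by rewrite !hornerE /GRing.scale/=; field.
Qed.

Lemma derivable_rational_curve (q : {poly K}) (G : 'M[{poly K}]_n) (t : K) :
  q.[t] != 0 -> derivable (rational_curve q G) t 1.
Proof.
move=> qt; apply/derivable_mxP => i j.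
rewrite (_ : (fun _ => _) = fun x => q.[x]^-1 * (G i j).[x]).
  exact: (@ex_derive _ _ _ _ _ _ _ (is_derive_rational_entry _ qt)).
by apply/funext => x; rewrite rational_curveE.
Qed.

Lemma derive1_rational_curve (q : {poly K}) (G : 'M[{poly K}]_n) :
  (forall t, q.[t] != 0) ->
  (rational_curve q G)^`()%classic =
  rational_curve (q ^+ 2) (\matrix_(i, j) (q * (G i j)^`() - q^`() * G i j)).
Proof.
move=> q0; apply/funext => t; rewrite derive1E derive_mx; last first.
  exact: derivable_rational_curve.
apply/matrixP => i j; rewrite mxE rational_curveE mxE.
rewrite (_ : (fun _ => _) = fun x => q.[x]^-1 * (G i j).[x]).
  exact: (@derive_val _ _ _ _ _ _ _ (is_derive_rational_entry _ (q0 t))).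
by apply/funext => x; rewrite rational_curveE.
Qed.

(** The quotient rule squares the common denominator and so keeps it free of zeros. Only this shape
    is recorded, since it already gives derivability at every order. *)
Lemma derive1n_rational_curve (q : {poly K}) (G : 'M[{poly K}]_n) k :
  (forall t, q.[t] != 0) ->
  exists q', exists G' : 'M[{poly K}]_n,
    (forall t, q'.[t] != 0) /\
    ((rational_curve q G)^`(k))%classic = rational_curve q' G'.
Proof.
move=> q0; elim: k => [|k [q' [G' [q'0 eG]]]]; first by exists q, G.
eexists; eexists; split; last by rewrite derive1nS eG; exact: derive1_rational_curve.
by move=> t; rewrite horner_exp expf_neq0.
Qed.

Lemma Ck_rational_curve k (q : {poly K}) (G : 'M[{poly K}]_n) (X : 'M[K]_n) :
  (forall t, q.[t] != 0) -> (forall t, orthogonal_mx (rational_curve q G t)) ->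
  rational_curve q G 0 = X -> Ck_curve k X (rational_curve q G).
Proof.
move=> q0 oG G0; split=> //.
  move=> j t _; have [q' [G' [q'0 ->]]] := derive1n_rational_curve G j q0.
  exact: derivable_rational_curve.
have [q' [G' [q'0 ->]]] := derive1n_rational_curve G k q0.
move=> t; apply: differentiable_continuous; apply/derivable1_diffP.
exact: derivable_rational_curve.
Qed.

End RationalCurve.

(** * The Cayley curve through [X] with velocity [X *m E] *)

Section Cayley.
Context (K : realType) (n : nat) (X E : 'M[K]_n).
Hypotheses (oX : orthogonal_mx X) (soE : so_mx E).

Definition cayley_den (t : K) : 'M[K]_n := 1%:M - (t / 2) *: E.
Definition cayley_num (t : K) : 'M[K]_n := 1%:M + (t / 2) *: E.

(** A row vector [v] killed by [cayley_den t] satisfies [v = (t / 2) v E], so its squared norm is a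
    multiple of [v E v^T], which vanishes for skew-symmetric [E]. *)
Lemma cayley_den_unit t : cayley_den t \in unitmx.
Proof.
rewrite -row_free_unit; apply/inj_row_free => v.
rewrite /cayley_den mulmxBr mulmx1 -scalemxAr => /eqP; rewrite subr_eq0 => /eqP vE.
have vEv : v *m E *m v^T = 0.
  (* A 1 x 1 matrix is its own transpose, so being skew-symmetric forces this one to be zero. *)
  have : (v *m E *m v^T)^T = - (v *m E *m v^T).
    by rewrite !trmx_mul trmxK soE mulNmx mulmxN mulmxA.
  move/matrixP/(_ 0 0); rewrite !mxE => /eqP.
  rewrite -addr_eq0 -mulr2n mulrn_eq0/= => /eqP e0.
  by apply/matrixP => i j; rewrite !ord1 [LHS]mxE [RHS]mxE.
have : v *m v^T = 0 by rewrite {1}vE -scalemxAl vEv scaler0.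
move/matrixP/(_ 0 0); rewrite !mxE => /eqP.
under eq_bigr do rewrite mxE.
rewrite psumr_eq0 => [/allP v0|i _]; last by rewrite -expr2 sqr_ge0.
apply/matrixP => i j; rewrite ord1 mxE.
by have := v0 j (mem_index_enum _); rewrite mulf_eq0 orbb => /eqP.
Qed.

Lemma tr_cayley_den t : (cayley_den t)^T = cayley_num t.
Proof. by rewrite /cayley_den raddfB/= trmx1 linearZ/= soE scalerN opprK. Qed.

Lemma cayleyC t : cayley_den t *m cayley_num t = cayley_num t *m cayley_den t.
Proof.
rewrite /cayley_den /cayley_num; set a := _ *: E.
rewrite [LHS]mulmxBl [RHS]mulmxDl !mul1mx mulmxDr mulmxBr !mulmx1.
by rewrite opprD addrACA.
Qed.

Definition cayley (t : K) : 'M[K]_n :=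
  X *m invmx (cayley_den t) *m cayley_num t.

(** Skew-symmetry makes transposition exchange numerator and denominator; as the two commute, they
    cancel against their inverses. *)
Lemma orthogonal_cayley t : orthogonal_mx (cayley t).
Proof.
rewrite /orthogonal_mx /cayley !trmx_mul trmx_inv.
have trN : (cayley_num t)^T = cayley_den t by rewrite -tr_cayley_den trmxK.
rewrite trN tr_cayley_den -!mulmxA (mulmxA X^T) oX mul1mx.
have uD := cayley_den_unit t.
have uN : cayley_num t \in unitmx by rewrite -tr_cayley_den unitmx_tr.
have e : invmx (cayley_den t) *m cayley_num t = cayley_num t *m invmx (cayley_den t).
  rewrite -[LHS](mulmxK uD) -(mulmxA _ _ (cayley_den t)) -cayleyC.
  by rewrite mulmxA mulVmx// mul1mx.
by rewrite e (mulmxA (invmx _)) mulVmx// mul1mx mulmxV.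
Qed.

(** The adjugate formula for the inverse supplies a common denominator: the determinant of
    [cayley_den t] as a polynomial in [t], without zeros by [cayley_den_unit]. *)
Lemma cayley_rational : exists q, exists G : 'M[{poly K}]_n,
  (forall t, q.[t] != 0) /\ cayley = rational_curve q G.
Proof.
pose D : 'M[{poly K}]_n := 1%:M - (2^-1 *: 'X) *: map_mx polyC E.
pose N : 'M[{poly K}]_n := 1%:M + (2^-1 *: 'X) *: map_mx polyC E.
have DE t : map_mx (horner_eval t) D = cayley_den t.
  apply/matrixP => i j; rewrite !mxE /horner_eval !hornerE/=.
  rewrite -[X in X - _]/((_ *+ _).[t]) hornerMn hornerC; congr (_ - _).
  by ring.
have NE t : map_mx (horner_eval t) N = cayley_num t.
  apply/matrixP => i j; rewrite !mxE /horner_eval !hornerE/=.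
  rewrite -[X in X + _]/((_ *+ _).[t]) hornerMn hornerC; congr (_ + _).
  by ring.
have detE t : (\det D).[t] = \det (cayley_den t).
  by rewrite -DE det_map_mx.
exists (\det D), (map_mx polyC X *m \adj D *m N); split => [t|].
  by have := cayley_den_unit t; rewrite unitmxE unitfE -detE.
apply/funext => t; rewrite /rational_curve !map_mxM/= NE map_mx_adj DE detE.
rewrite /cayley /invmx cayley_den_unit -scalemxAr -scalemxAl.
congr (_ *: (_ *m _ *m _)).
by apply/matrixP => i j; rewrite !mxE /horner_eval hornerC.
Qed.

Lemma cayley0 : cayley 0 = X.
Proof.
by rewrite /cayley /cayley_den /cayley_num mul0r scale0r subr0 addr0 invmx1 !mulmx1.
Qed.

Lemma Ck_cayley k : Ck_curve k X cayley.
Proof.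
have [q [G [q0 eG]]] := cayley_rational.
have oG t : orthogonal_mx (rational_curve q G t) by rewrite -eG; exact: orthogonal_cayley.
by rewrite eG; apply: Ck_rational_curve => //; rewrite -eG cayley0.
Qed.

(* Clearing the denominator, [g t = X + t / 2 (X E + g t E)], whose derivative
   at [0] only involves [g 0]. *)
Lemma derive1_cayley0 : (cayley^`())%classic 0 = X *m E.
Proof.
have cayleyE t : cayley t = X + (t / 2) *: (X *m E + cayley t *m E).
  have : cayley t *m cayley_den t = X *m cayley_num t.
    by rewrite /cayley -mulmxA -cayleyC mulmxA mulmxKV// cayley_den_unit.
  rewrite /cayley_den /cayley_num mulmxBr mulmxDr !mulmx1 -!scalemxAr => /eqP.
  by rewrite subr_eq -addrA -scalerDr => /eqP.
apply/matrixP => i j.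
have dc l := Ck_curve_is_derive (j := 0) (0 : K) i l (Ck_cayley 1) isT.
rewrite derive1n1 derive1n0 in dc.
pose h x := (X *m E) i j + \sum_l cayley x i l * E l j.
have dh : is_derive (0 : K) 1 h
    (0 + \sum_l (cayley 0 i l * 0 + E l j * (cayley^`())%classic 0 i l)).
  apply: is_deriveD; apply: is_derive_fsum => l.
  exact: is_derive_mul (dc l) (is_derive_cst _ _ _).
have di : is_derive (0 : K) 1 (fun x : K => x) 1 by exact: is_derive_id.
have := is_deriveD (is_derive_cst (X i j) (0 : K) 1)
  (is_deriveZ 2^-1 (is_derive_mul di dh)).
rewrite (_ : _ + _ = fun x => cayley x i j); last first.
  apply/funext => x; rewrite [in RHS]cayleyE /h /= /cst !mxE.
  rewrite -[LHS]/(_ + 2^-1 * (x * _)); ring.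
move=> /(@derive_val _ _ _ _ _ _ _); rewrite (@derive_val _ _ _ _ _ _ _ (dc j)) => ->.
rewrite add0r mul0r add0r mulr1 /h cayley0 /GRing.scale/=.
rewrite -[_ + \sum_l _]/((X *m E) i j + \sum_l X i l * E l j).
have -> : \sum_l X i l * E l j = (X *m E) i j by rewrite mxE.
by field.
Qed.
End Cayley.

(** * The standard basis of so(n) and the index of a diagonal form *)

Lemma E_mxE (K : realType) n (p q i j : 'I_n) : E_mx K p q i j =
  ((i == q) && (j == p))%:R - ((i == p) && (j == q))%:R.
Proof. by rewrite !mxE. Qed.

Lemma so_E_mx (K : realType) n (p q : 'I_n) : so_mx (E_mx K p q).
Proof. by rewrite /so_mx /E_mx raddfB/= !trmx_delta opprB. Qed.

Lemma neq0_mx (K : realType) m n (E : 'M[K]_(m, n)) :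
  E != 0 -> exists i j, E i j != 0.
Proof.
move=> En0; suff /existsP[i /existsP[j Eij]] : [exists i, exists j, E i j != 0].
  by exists i, j.
apply: contraNT En0 => /existsPn E0; apply/eqP/matrixP => i j; rewrite mxE.
by have /existsPn/(_ j)/negbNE/eqP := E0 i.
Qed.

Section DiagonalIndex.
Context (K : realType) (n : nat) (w : 'I_n -> 'I_n -> K).
(** [N] is to hold exactly one orientation of each unordered pair with negative weight, so that
    [#|N|] counts each negative square once although [form] sums over both orders. *)
Context (N : {set 'I_n * 'I_n}).
Hypothesis wN : forall p q, (w p q < 0) = ((p, q) \in N) || ((q, p) \in N).
Hypothesis antiN : forall p q, (p, q) \in N -> (q, p) \notin N.

Local Notation form E := (\sum_p \sum_q E p q ^+ 2 * w p q).

Definition coords_on (E : 'M[K]_n) : 'rV[K]_#|N| :=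
  \row_k E (enum_val k).1 (enum_val k).2.

Fact coords_on_linear : linear coords_on.
Proof. by move=> c E F; apply/rowP => k; rewrite !mxE. Qed.

HB.instance Definition _ :=
  GRing.isLinear.Build K 'M[K]_n 'rV[K]_#|N| *:%R coords_on coords_on_linear.

(** The indices of [E_mx] are swapped because, for distinct [p] and [q], [E_mx K q p] has entry [1]
    at [(p, q)]; thus [coords_on] undoes [span_on] without a sign. *)
Definition span_on (v : 'rV[K]_#|N|) : 'M[K]_n :=
  \sum_k v 0 k *: E_mx K (enum_val k).2 (enum_val k).1.

Fact span_on_linear : linear span_on.
Proof.
move=> c u v; rewrite /span_on scaler_sumr -big_split; apply: eq_bigr => k _ /=.
by rewrite !mxE scalerDl scalerA.
Qed.

HB.instance Definition _ :=
  GRing.isLinear.Build K 'rV[K]_#|N| 'M[K]_n *:%R span_on span_on_linear.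

Lemma so_span_on v : so_mx (span_on v).
Proof.
rewrite /so_mx /span_on linear_sum -sumrN; apply: eq_bigr => k _.
by rewrite linearZ/= so_E_mx scalerN.
Qed.

(** A basis vector could disturb another coordinate only through its entry [-1] at the reversed
    pair, and [antiN] keeps reversed pairs out of [N]. *)
Lemma span_onK : cancel span_on coords_on.
Proof.
move=> v; apply/rowP => k; rewrite mxE summxE (bigD1 k)//= big1 => [|l lk].
  rewrite addr0 mxE E_mxE !eqxx/=.
  have := enum_valP k; case: (enum_val k) => p q /= pqN.
  case: eqP => [pq|_]; last by rewrite subr0 mulr1.
  by have := antiN pqN; rewrite -pq in pqN *; rewrite pqN.
rewrite mxE E_mxE.
have : enum_val k != enum_val l by rewrite (inj_eq enum_val_inj) eq_sym.
have := enum_valP k; have := enum_valP l.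
case: (enum_val k) (enum_val l) => [p q] [p' q'] /= lN kN kl.
rewrite -pair_eqE /= in kl; rewrite (negbTE kl).
case: andP => [[/eqP pq' /eqP qp']|]; last by rewrite subr0 mulr0.
by have := antiN lN; rewrite -pq' -qp' kN.
Qed.

Lemma span_on_supp v i j : span_on v i j != 0 -> w i j < 0.
Proof.
rewrite wN; apply: contraNT; rewrite negb_or => /andP[Nij Nji].
rewrite summxE big1// => k _; rewrite mxE E_mxE.
have := enum_valP k; case: (enum_val k) => p q /= pqN.
case: andP => [[/eqP ip /eqP jq]|_]; first by rewrite ip jq pqN in Nij.
case: andP => [[/eqP iq /eqP jp]|_]; first by rewrite iq jp pqN in Nji.
by rewrite subrr mulr0.
Qed.

Lemma form_lt0 (E : 'M[K]_n) : (forall i j, E i j != 0 -> w i j < 0) ->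
  E != 0 -> form E < 0.
Proof.
move=> Ew /neq0_mx[i [j Eij]].
have le0 p q : E p q ^+ 2 * w p q <= 0.
  have [->|/Ew/ltW] := eqVneq (E p q) 0; first by rewrite expr0n mul0r.
  by move=> wpq; rewrite mulr_ge0_le0// sqr_ge0.
rewrite (bigD1 i)//= ltr_wnDr//; first by apply: sumr_le0 => p _; apply: sumr_le0.
rewrite (bigD1 j)//= ltr_wnDr//; first by apply: sumr_le0.
by rewrite pmulr_rlt0 ?Ew// exprn_even_gt0.
Qed.

(** Lower bound: the image of [span_on] is negative definite of dimension [#|N|]. Upper bound:
    [coords_on] is injective on every negative definite [V], since a skew-symmetric [E] in its
    kernel vanishes wherever [w] is negative, which makes [form E] nonnegative. *)
Lemma has_index_diag (H : 'M[K]_n -> 'M[K]_n -> K) :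
  (forall E, so_mx E -> H E E = form E) -> has_index H #|N|.
Proof.
move=> HE.
have dimN : \dim {:'rV[K]_#|N|} = #|N| by rewrite dimvf dim_matrix; exact: mul1r.
split.
  exists (limg (linfun span_on)); split.
  - by move=> E /memv_imgP[v _ ->]; rewrite lfunE; exact: so_span_on.
  - move=> E /memv_imgP[v _ ->]; rewrite lfunE/= => v0.
    by rewrite HE; [apply: form_lt0 => // i j; exact: span_on_supp|exact: so_span_on].
  - rewrite limg_dim_eq//; apply/eqP; rewrite -subv0; apply/subvP => v.
    rewrite memv_cap memv_ker lfunE/= memv0 => /andP[_ /eqP v0].
    by rewrite -(span_onK v) v0 linear0.
move=> V soV negV; rewrite -dimN.
rewrite -(@limg_dim_eq _ _ _ (linfun coords_on) V); first exact/dimvS/subvf.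
apply/eqP; rewrite -subv0; apply/subvP => E.
rewrite memv_cap memv_ker lfunE/= memv0 => /andP[EV /eqP E0].
have soE := soV _ EV.
apply: contraT => /(negV _ EV); rewrite HE// ltNge => /negP[].
apply: sumr_ge0 => p _; apply: sumr_ge0 => q _.
have E0N i j : (i, j) \in N -> E i j = 0.
  move=> ijN; have /rowP/(_ (enum_rank_in ijN (i, j))) := E0.
  by rewrite !mxE enum_rankK_in.
(* Where [w p q] is negative, either [(p, q)] lies in [N], or [(q, p)] does and the entry vanishes
   by skew-symmetry. *)
case: ltP (wN p q) => [_ /esym/orP[/E0N ->|/E0N qp]|w0 _].
- by rewrite expr0n mul0r.
- have -> : E p q = 0 by have /matrixP/(_ q p) := soE; rewrite !mxE qp oppr0.
  by rewrite expr0n mul0r.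
- by rewrite mulr_ge0 ?sqr_ge0.
Qed.

End DiagonalIndex.

(** * Uniqueness of the Hessian and its values on the basis *)

Section HessianUnique.
Context (K : realType) (n : nat) (S : 'M[K]_n) (sigma : 'S_n).
Hypothesis hS : sign_mx S.
Context (alpha beta : 'rV[K]_n) (H : 'M[K]_n -> 'M[K]_n -> K).
Hypothesis hH : hessian (trace_fun alpha beta) (S *m P_mx K sigma) H.
Local Notation H0 := (diag_hessian sigma alpha beta).

Lemma hessian_quadE E : so_mx E -> H E E = H0 E E.
Proof.
move=> so; pose X := S *m P_mx K sigma.
have oX : orthogonal_mx X := orthogonal_signed_perm sigma hS.
have gP := Ck_cayley oX so 2; have g' := derive1_cayley0 oX so.
have [_ d1] := hH.2 _ _ gP so g'.
have [_ d2] := (hessian_signed_perm sigma hS alpha beta).2 _ _ gP so g'.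
by rewrite -(@derive_val _ _ _ _ _ _ _ d1) (@derive_val _ _ _ _ _ _ _ d2).
Qed.

Lemma hessian_polarE E F : so_mx E -> so_mx F -> H E F = H0 E F.
Proof.
move=> soE soF.
have soEF : so_mx (E + F) by rewrite /so_mx linearD/= soE soF opprD.
(* Polarization stays within so(n), where the forms are known to be symmetric and bilinear. *)
have pol (B : 'M[K]_n -> 'M[K]_n -> K) : sym_bilinear_on_so B ->
    B (E + F) (E + F) = B E E + 2 * B E F + B F F.
  move=> [symB linB].
  have addB G : so_mx G -> B (E + F) G = B E G + B F G.
    by move=> soG; rewrite -[in LHS](scale1r E) linB// mul1r.
  rewrite addB// (symB E (E + F))// (symB F (E + F))// !addB//.
  by rewrite (symB F E)//; ring.
have := hessian_quadE soEF.
rewrite (pol _ hH.1) (pol _ (hessian_signed_perm sigma hS alpha beta).1).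
rewrite !hessian_quadE// => /addIr/addrI/mulfI; apply.
by rewrite pnatr_eq0.
Qed.

End HessianUnique.

(** Only the entries [(q, p)] and [(p, q)] contribute, and they do so equally because [F] is
    skew-symmetric and the weight symmetric. Keeping [F] general covers both the diagonal and the
    off-diagonal values. *)
Lemma diag_hessian_E_mx (K : realType) n (sigma : 'S_n) (alpha beta : 'rV[K]_n) p q F :
  so_mx F ->
  diag_hessian sigma alpha beta (E_mx K p q) F =
  2 * F q p * ((beta 0 p - beta 0 q) * (alpha 0 (sigma q) - alpha 0 (sigma p))).
Proof.
move=> so; rewrite /diag_hessian.
set w := fun i j => (beta 0 i - beta 0 j) * (alpha 0 (sigma j) - alpha 0 (sigma i)).
have dsum k l : \sum_i \sum_j ((i == k) && (j == l))%:R * (F i j * w i j) = F k l * w k l.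
  rewrite (bigD1 k)//= [X in _ + X]big1 ?addr0 => [|i ik]; last first.
    by rewrite big1// => j _; rewrite (negbTE ik) mul0r.
  rewrite (bigD1 l)//= big1 ?addr0 ?eqxx ?mul1r// => j jl.
  by rewrite (negbTE jl) andbF mul0r.
transitivity (F q p * w q p - F p q * w p q).
  rewrite -!dsum -sumrB; apply: eq_bigr => i _; rewrite -sumrB.
  by apply: eq_bigr => j _; rewrite E_mxE -mulrBl -mulrA.
have -> : F p q = - F q p by have /matrixP/(_ q p) := so; rewrite !mxE.
by rewrite /w; ring.
Qed.

(** * Global indices versus block and local indices *)

Definition pos n s (m : 'I_s -> nat) (hm : (\sum_i m i)%N = n) i (u : 'I_(m i)) : 'I_n :=
  cast_ord hm (tagnat.Rank i u).

Definition blk n s (m : 'I_s -> nat) (hm : (\sum_i m i)%N = n) (p : 'I_n) : 'I_s :=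
  tagnat.sig1 (cast_ord (esym hm) p).

Section Blocks.
Context (n s : nat) (m : 'I_s -> nat) (hm : (\sum_i m i)%N = n).

Lemma posP (p : 'I_n) : exists i (u : 'I_(m i)), p = pos hm u.
Proof.
exists _, (tagnat.sig2 (cast_ord (esym hm) p)).
by rewrite /pos tagnat.sig2K cast_ordKV.
Qed.

Lemma blk_pos i (u : 'I_(m i)) : blk hm (pos hm u) = i.
Proof. by rewrite /blk cast_ordK tagnat.Rank1K. Qed.

Lemma pos_inj i : injective (@pos n s m hm i).
Proof.
move=> u v /cast_ord_inj/(congr1 val)/eqP.
by rewrite tagnat.eq_Rank eqxx => /eqP/val_inj.
Qed.

Lemma big_pos (F : 'I_n -> nat) :
  (\sum_p F p = \sum_i \sum_(u < m i) F (pos hm u))%N.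
Proof.
rewrite (reindex (cast_ord hm))/=; last first.
  by exists (cast_ord (esym hm)) => p _; rewrite ?cast_ordK ?cast_ordKV.
rewrite (reindex (@tagnat.rank s m))/=; last exact/onW_bij/tagnat.rank_bij.
by rewrite sig_big_dep; apply: eq_bigr => -[].
Qed.

Lemma big_pos_blk (F : 'I_n -> nat) i :
  (\sum_(u < m i) F (pos hm u) = \sum_(p | blk hm p == i) F p)%N.
Proof.
rewrite [RHS]big_mkcond big_pos (bigD1 i)//= [X in (_ + X)%N]big1 ?addn0.
  by apply: eq_bigr => u _; rewrite blk_pos eqxx.
by move=> k ki; rewrite big1// => u _; rewrite blk_pos (negbTE ki).
Qed.

Lemma block_scalarE (K : realType) (a : 'I_s -> K) :
  block_scalar hm a = diag_mx (\row_p a (blk hm p)).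
Proof.
apply/matrixP => p q; have [i [u ->]] := posP p; have [j [v ->]] := posP q.
rewrite castmxE !cast_ordK /=.
have -> (M : 'M[K]_(\sum_i m i)) :
    M (tagnat.Rank i u) (tagnat.Rank j v) = submxblock M i j u v.
  by rewrite mxE.
rewrite mxblockK !mxE blk_pos.
have [ij|ij] := eqVneq i j.
  case: _ / ij in v *; rewrite conform_mx_id mxE.
  by rewrite (inj_eq (@pos_inj i)).
rewrite mxE; case: eqP => // /(congr1 (blk hm)); rewrite !blk_pos => ij'.
by rewrite ij' eqxx in ij.
Qed.

End Blocks.

(** The type of [tagnat.sig2] depends on the value of [tagnat.sig1], so the two are simplified
    together, under an arbitrary dependent [F]. *)
Lemma tagnat_sig12 s (p_ : 'I_s -> nat) T (F : forall j, 'I_(p_ j) -> T) j k :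
  F (tagnat.sig1 (tagnat.Rank j k)) (tagnat.sig2 (tagnat.Rank j k)) = F j k.
Proof. by rewrite /tagnat.sig1 /tagnat.sig2 /tagnat.Rank tagnat.rankK. Qed.

(** * The perfect filling of a signed permutation matrix *)

Section Filling.
Context (K : realType) (n s t : nat) (m : 'I_s -> nat) (nn : 'I_t -> nat).
Context (hm : (\sum_i m i)%N = n) (hn : (\sum_j nn j)%N = n).
Context (S : 'M[K]_n) (sigma : 'S_n).
Hypothesis hS : sign_mx S.
Local Notation X := (S *m P_mx K sigma).
Local Notation eps := (nonzero_count hm hn X).

Lemma block_signed_perm i j u v :
  block hm hn X i j u v =
  S (pos hm u) (pos hm u) * (pos hm u == sigma (pos hn v))%:R.
Proof. by rewrite mxE castmxE !esymK (signed_permE _ hS). Qed.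

Lemma block_neq0 i j u v :
  (block hm hn X i j u v != 0) = (pos hm u == sigma (pos hn v)).
Proof.
rewrite block_signed_perm mulf_eq0 (negbTE (sign_mx_neq0 hS _)).
by rewrite pnatr_eq0 eqb0 negbK.
Qed.

(** Column [q] has its one nonzero entry in row [sigma q], so counting nonzero entries is counting
    columns. This turns later sums of [eps] into sums over [q]. *)
Lemma nonzero_countE i j :
  eps i j = (\sum_q ((blk hm (sigma q) == i) && (blk hn q == j)))%N.
Proof.
rewrite mxE -sum1_card big_mkcond.
rewrite -(pair_bigA _ (fun u v => if block hm hn X i j u v != 0 then 1%N else 0%N))/=.
rewrite exchange_big/=.
transitivity (\sum_(v < nn j) (blk hm (sigma (pos hn v)) == i))%N.
  apply: eq_bigr => v _.
  under eq_bigr => u _ do rewrite block_neq0 -/(nat_of_bool _).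
  rewrite (big_pos_blk hm (fun p => p == sigma (pos hn v))).
  rewrite big_mkcond (bigD1 (sigma (pos hn v)))//= eqxx big1 ?addn0.
    by case: ifP.
  by move=> p /negbTE ->; rewrite if_same.
rewrite (big_pos_blk hn (fun q => blk hm (sigma q) == i)) big_mkcond.
by apply: eq_bigr => q _; rewrite andbC; case: (blk hn q == j).
Qed.

(** Each column has its nonzero entry in exactly one block. A row sum therefore counts the [q] with
    [sigma q] in row block [i], and there are [m i] of them because [sigma] is a bijection; a column
    sum counts the columns of block [j]. *)
Lemma perfect_nonzero_count : perfect_filling m nn eps.
Proof.
have sum_eq k (c : 'I_k) : (\sum_(j < k) (c == j))%N = 1%N.
  by rewrite (bigD1 c)//= eqxx big1 ?addn0// => j /negbTE; rewrite eq_sym => ->.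
split=> [i|j].
- under eq_bigr do rewrite nonzero_countE.
  rewrite exchange_big/=.
  transitivity (\sum_q (blk hm (sigma q) == i))%N.
    apply: eq_bigr => q _; case: eqP => _ /=; last by rewrite big1.
    by rewrite sum_eq.
  rewrite -(reindex_inj (@perm_inj _ sigma)
    (F := fun p => nat_of_bool (blk hm p == i)) (P := xpredT))/=.
  rewrite -[RHS](card_ord (m i)) -sum1_card (big_pos_blk hm (fun=> 1%N)) [RHS]big_mkcond.
  by apply: eq_bigr => p _; case: eqP.
- under eq_bigr do rewrite nonzero_countE.
  rewrite exchange_big/=.
  transitivity (\sum_q (blk hn q == j))%N.
    apply: eq_bigr => q _; case: (blk hn q == j); last first.
      by rewrite big1// => i _; rewrite andbF.
    by under eq_bigr do rewrite andbT; rewrite sum_eq.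
  rewrite -[RHS](card_ord (nn j)) -sum1_card (big_pos_blk hn (fun=> 1%N)) [RHS]big_mkcond.
  by apply: eq_bigr => p _; case: eqP.
Qed.

Let h := perfect_nonzero_count.

Lemma eps_card i j : eps i j =
  #|[pred uv : 'I_(m i) * 'I_(nn j) | block hm hn X i j uv.1 uv.2 != 0]|.
Proof. by rewrite mxE. Qed.

Definition nz_pos i j (k : 'I_(eps i j)) : 'I_(m i) * 'I_(nn j) :=
  enum_val (cast_ord (eps_card i j) k).

Lemma nz_posP i j (k : 'I_(eps i j)) :
  pos hm (nz_pos k).1 = sigma (pos hn (nz_pos k).2).
Proof.
apply/eqP; rewrite -block_neq0.
exact: (enum_valP (cast_ord (eps_card i j) k)).
Qed.

Lemma nz_pos_inj i j : injective (@nz_pos i j).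
Proof. by move=> k l /enum_val_inj/cast_ord_inj. Qed.

Lemma nz_pos_surj i j u v : pos hm u = sigma (pos hn v) ->
  exists k : 'I_(eps i j), nz_pos k = (u, v).
Proof.
move=> e; have uvP : (u, v) \in
    [pred uv : 'I_(m i) * 'I_(nn j) | block hm hn X i j uv.1 uv.2 != 0].
  by rewrite inE block_neq0 e.
exists (cast_ord (esym (eps_card i j)) (enum_rank_in uvP (u, v))).
by rewrite /nz_pos cast_ordKV enum_rankK_in.
Qed.

(** Column [c] of [Q i] is the [k]-th column of some [Q[i, j]], as encoded by [d]; its nonzero entry
    is put in the row of the [k]-th nonzero position of block [(i, j)]. [col_of] does the same for
    [R j]. *)
Definition row_of i (c : 'I_(m i)) : 'I_(m i) :=
  let d := cast_ord (esym (h.1 i)) c in (nz_pos (tagnat.sig2 d)).1.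

Definition col_of j (c : 'I_(nn j)) : 'I_(nn j) :=
  let d := cast_ord (esym (h.2 j)) c in (nz_pos (tagnat.sig2 d)).2.

Lemma row_of_Rank i j (k : 'I_(eps i j)) :
  row_of (cast_ord (h.1 i) (tagnat.Rank j k)) = (nz_pos k).1.
Proof.
rewrite /row_of /= cast_ordK.
exact: (@tagnat_sig12 t (fun j => eps i j) _ (fun j k => (@nz_pos i j k).1)).
Qed.

Lemma col_of_Rank i j (k : 'I_(eps i j)) :
  col_of (cast_ord (h.2 j) (tagnat.Rank (p_ := fun i => eps i j) i k)) = (nz_pos k).2.
Proof.
rewrite /col_of /= cast_ordK.
exact: (@tagnat_sig12 s (fun i => eps i j) _ (fun i k => (@nz_pos i j k).2)).
Qed.

(** By [nz_posP] a row determines the column of its nonzero entry, hence the column block [j] and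
    the position itself, which occurs for only one [k]. *)
Lemma row_of_inj i : injective (@row_of i).
Proof.
move=> c c'.
have [j [k ->]] := posP (h.1 i) c; have [j' [k' ->]] := posP (h.1 i) c'.
rewrite !row_of_Rank => e.
have := nz_posP k; rewrite e nz_posP => /perm_inj e2.
have jj : j = j' by have /(congr1 (blk hn)) := e2; rewrite !blk_pos.
case: _ / jj in k' e e2 *.
congr (pos _ _); apply: nz_pos_inj.
by rewrite [LHS]surjective_pairing [RHS]surjective_pairing e (pos_inj e2).
Qed.

Lemma col_of_inj j : injective (@col_of j).
Proof.
move=> c c'.
have [i [k ->]] := posP (h.2 j) c; have [i' [k' ->]] := posP (h.2 j) c'.
rewrite !col_of_Rank => e.
have := nz_posP k; rewrite e -nz_posP => e2.
have ii : i = i' by have /(congr1 (blk hm)) := e2; rewrite !blk_pos.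
case: _ / ii in k' e e2 *.
congr (pos _ _); apply: nz_pos_inj.
by rewrite [LHS]surjective_pairing [RHS]surjective_pairing e (pos_inj e2).
Qed.

Definition Q_of i : 'M[K]_(m i) :=
  diag_mx (\row_u S (pos hm u) (pos hm u)) *m P_mx K (perm (@row_of_inj i)).

Definition R_of j : 'M[K]_(nn j) := P_mx K (perm (@col_of_inj j)).

Lemma P_mxE k (tau : 'S_k) i j : P_mx K tau i j = (i == tau j)%:R.
Proof. by rewrite !mxE. Qed.

Lemma sign_Q_of i : sign_mx (diag_mx (\row_(u < m i) S (pos hm u) (pos hm u))).
Proof.
split; first exact: diag_mx_is_diag.
by move=> u; rewrite !mxE eqxx mulr1n; exact: hS.2.
Qed.

Lemma Q_ofE i u c : Q_of i u c = S (pos hm u) (pos hm u) * (u == row_of c)%:R.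
Proof. by rewrite (signed_permE _ (sign_Q_of i)) permE !mxE eqxx mulr1n. Qed.

(** Entry [(u, v)] of block [(i, j)] is the sign of row [u] times the number of [k] with
    [nz_pos k = (u, v)]. As [nz_pos] lists the nonzero positions without repetition, that number is
    1 at a nonzero entry of [X] and 0 elsewhere. *)
Lemma Phi_Q_R : X = Phi hm hn h Q_of R_of.
Proof.
apply/matrixP => p q; have [i [u ->]] := posP hm p; have [j [v ->]] := posP hn q.
rewrite castmxE !cast_ordK.
set M := mxblock _.
have -> : M (tagnat.Rank i u) (tagnat.Rank j v) = submxblock M i j u v by rewrite [RHS]mxE.
rewrite /M mxblockK [RHS]mxE.
rewrite (signed_permE _ hS).
have termE k : submxrow (q_ := fun j' => eps i j')
      (castmx (erefl, esym (h.1 i)) (Q_of i)) j u k *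
    (submxrow (q_ := fun i' => eps i' j)
      (castmx (erefl, esym (h.2 j)) (R_of j)) i)^T k v =
    S (pos hm u) (pos hm u) * ((u, v) == nz_pos k)%:R.
  rewrite !mxE !castmxE /= !cast_ord_id !esymK Q_ofE P_mxE permE row_of_Rank col_of_Rank.
  by rewrite -mulrA -natrM mulnb -pair_eqE.
rewrite (eq_bigr _ (fun k _ => termE k)).
rewrite -mulr_sumr; congr (_ * _).
have [e|ne] := eqVneq (pos hm u) _.
  have [k ek] := nz_pos_surj e.
  rewrite (bigD1 k)//= ek eqxx big1 ?addr0// => l lk.
  by rewrite -ek (inj_eq (@nz_pos_inj i j)) eq_sym (negbTE lk).
rewrite big1// => k _; case: eqP => // uv.
by have := nz_posP k; rewrite -uv /= => e; rewrite e eqxx in ne.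
Qed.

Lemma signed_Q i : signed_perm_mx (Q_of i).
Proof. by eexists; eexists; split; first exact: sign_Q_of. Qed.

Lemma orthogonal_R j : orthogonal_mx (R_of j).
Proof.
apply: signed_perm_orthogonal; exists 1%:M, (perm (@col_of_inj j)).
rewrite mul1mx; split=> //; split; first exact: scalar_mx_is_diag.
by move=> i; left; rewrite mxE eqxx.
Qed.

Lemma perm_R j : is_perm_mx (R_of j).
Proof.
(* [P_mx] is the transpose of [perm_mx], hence the inverse permutation. *)
apply/is_perm_mxP; exists (perm (@col_of_inj j))^-1%g.
apply/matrixP => a b; rewrite P_mxE !mxE.
by rewrite (canF_eq (permKV _)).
Qed.

(** Sorts the [q] by the cell [(r q, c q)], each [q] lying in a single one. By [nonzero_countE] the
    fibre sizes are the entries of [eps] when [r] and [c] are the row and column blocks. *)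
Lemma sum_fibres (P : pred 'I_s) (Q : pred 'I_t) (I : finType)
    (r : I -> 'I_s) (c : I -> 'I_t) (G : 'I_s -> 'I_t -> nat) :
  (\sum_(k | P k) \sum_(l | Q l) (\sum_q ((r q == k) && (c q == l))) * G k l =
   \sum_(q | P (r q) && Q (c q)) G (r q) (c q))%N.
Proof.
under eq_bigr => k _.
  under eq_bigr do rewrite big_distrl/=.
  rewrite exchange_big/=; over.
rewrite exchange_big/= [RHS]big_mkcond; apply: eq_bigr => q _.
have [Pr|Pr] := boolP (P (r q)); last first.
  rewrite big1// => k Pk; rewrite big1// => l _; case: eqP => // e.
  by rewrite e Pk in Pr.
rewrite (bigD1 (r q))//= eqxx /= [X in (_ + X)%N]big1 ?addn0; last first.
  by move=> k /andP[_ /negbTE]; rewrite eq_sym => ->; rewrite big1.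
have [Qc|Qc] := boolP (Q (c q)); last first.
  rewrite big1// => l Ql; case: eqP => // e.
  by rewrite e Ql in Qc.
rewrite (bigD1 (c q))//= eqxx mul1n big1 ?addn0// => l /andP[_ /negbTE].
by rewrite eq_sym => ->.
Qed.

(** The product [eps i j * eps k l] counts pairs of columns with nonzero entries in blocks [(i, j)]
    and [(k, l)]. The second column is summed first, into [G], and then the first one. *)
Lemma inversions_nonzero_count :
  #|[set pq : 'I_n * 'I_n | (blk hn pq.1 < blk hn pq.2)%N &&
      (blk hm (sigma pq.1) < blk hm (sigma pq.2))%N]| =
  (\sum_(i < s) \sum_(j < t) \sum_(k < s | (i < k)%N)
     \sum_(l < t | (j < l)%N) eps i j * eps k l)%N.
Proof.
pose G (i : 'I_s) (j : 'I_t) :=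
  (\sum_(q' | (i < blk hm (sigma q'))%N && (j < blk hn q')%N) 1)%N.
transitivity (\sum_i \sum_j eps i j * G i j)%N; last first.
  apply: eq_bigr => i _; apply: eq_bigr => j _.
  rewrite /G -(@sum_fibres (fun k => i < k)%N (fun l => j < l)%N _
    (fun q => blk hm (sigma q)) (blk hn) (fun _ _ => 1%N)).
  rewrite big_distrr; apply: eq_bigr => k _; rewrite big_distrr; apply: eq_bigr => l _ /=.
  by rewrite muln1 (nonzero_countE k l).
under [RHS]eq_bigr do under eq_bigr do rewrite nonzero_countE.
rewrite (@sum_fibres xpredT xpredT _ (fun q => blk hm (sigma q)) (blk hn) G)/=.
rewrite -sum1_card pair_big_dep/=.
by apply: eq_bigl => pq; rewrite inE andbC.
Qed.

End Filling.

(** * Signs of the coefficients and conclusion *)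

Lemma incr_ltE (K : realType) s (a : 'I_s -> K) :
  (forall i i' : 'I_s, (i < i')%N -> a i < a i') ->
  forall i i', (a i < a i') = (i < i')%N.
Proof.
move=> a_incr i i'; case: (ltngtP i i') => [/a_incr//|/a_incr/lt_gtF//|/val_inj ->].
exact: ltxx.
Qed.

(** The two ways for the product to be negative are exchanged by reversing the pair; they become the
    two orientations in the hypothesis [wN]. *)
Lemma mulrB_lt0 (K : realType) (x y u v : K) :
  ((x - y) * (v - u) < 0) = ((x < y) && (u < v)) || ((y < x) && (v < u)).
Proof.
case: (ltgtP x y) => [xy|yx|->] /=; last by rewrite subrr mul0r ltxx.
- by rewrite orbF nmulr_rlt0 ?subr_lt0// subr_gt0.
- by rewrite pmulr_rlt0 ?subr_gt0// subr_lt0.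
Qed.

Theorem theorem2p16 (K : realType) (n s t : nat) (n_ge1 : (1 <= n)%N)
    (m : 'I_s -> nat) (nn : 'I_t -> nat)
    (m_ge1 : forall i, (1 <= m i)%N) (nn_ge1 : forall j, (1 <= nn j)%N)
    (hm : (\sum_i m i)%N = n) (hn : (\sum_j nn j)%N = n)
    (a : 'I_s -> K) (b : 'I_t -> K)
    (a_incr : forall i i' : 'I_s, (i < i')%N -> a i < a i')
    (b_incr : forall j j' : 'I_t, (j < j')%N -> b j < b j')
    (S : 'M[K]_n) (sigma : 'S_n) (hS : sign_mx S) :
  let A := block_scalar hm a in
  let B := block_scalar hn b in
  let f := fun Y : 'M[K]_n => \tr (A *m Y *m B *m Y^T) in
  let X := S *m P_mx K sigma in
  let eps := nonzero_count hm hn X in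
  [/\ critical_point f X,
      exists h : perfect_filling m nn eps,
      exists Q : (forall i, 'M[K]_(m i)), exists R : (forall j, 'M[K]_(nn j)),
        [/\ forall i, orthogonal_mx (Q i),
            forall j, orthogonal_mx (R j),
            X = Phi hm hn h Q R,
            forall i, signed_perm_mx (Q i)
          & forall j, is_perm_mx (R j)],
      exists H : 'M[K]_n -> 'M[K]_n -> K, hessian f X H
    & forall H : 'M[K]_n -> 'M[K]_n -> K, hessian f X H ->
      [/\ forall p q p' q' : 'I_n, (p < q)%N -> (p' < q')%N ->
            (p, q) != (p', q') -> H (E_mx K p q) (E_mx K p' q') = 0,
          forall p q : 'I_n, (p < q)%N ->
            H (E_mx K p q) (E_mx K p q) =
              2 * (B p p - B q q) *
              (A (sigma q) (sigma q) - A (sigma p) (sigma p)),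
          has_index H
            #|[pred pq : 'I_n * 'I_n | (B pq.1 pq.1 < B pq.2 pq.2) &&
                 (A (sigma pq.2) (sigma pq.2) > A (sigma pq.1) (sigma pq.1))]|
        & has_index H
            (\sum_(i < s) \sum_(j < t) \sum_(k < s | (i < k)%N)
               \sum_(l < t | (j < l)%N) eps i j * eps k l)%N]].
Proof.
move=> A B f X eps.
pose alpha := \row_p a (blk hm p); pose beta := \row_q b (blk hn q).
have AE : A = diag_mx alpha by exact: block_scalarE.
have BE : B = diag_mx beta by exact: block_scalarE.
have fE : f = trace_fun alpha beta by rewrite /f AE BE.
have App p : A p p = alpha 0 p by rewrite AE mxE eqxx mulr1n.
have Bpp p : B p p = beta 0 p by rewrite BE mxE eqxx mulr1n.
have a_lt := incr_ltE a_incr; have b_lt := incr_ltE b_incr.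
rewrite fE; split.
- exact: critical_signed_perm.
- exists (perfect_nonzero_count hm hn sigma hS).
  exists (Q_of hm hn sigma hS), (R_of hm hn sigma hS); split=> [i|j||i|j].
  + exact/signed_perm_orthogonal/signed_Q.
  + exact: orthogonal_R.
  + exact: Phi_Q_R.
  + exact: signed_Q.
  + exact: perm_R.
- by exists (diag_hessian sigma alpha beta); exact: hessian_signed_perm.
move=> H hH.
have HE p q F : so_mx F -> H (E_mx K p q) F =
    2 * F q p * ((beta 0 p - beta 0 q) * (alpha 0 (sigma q) - alpha 0 (sigma p))).
  move=> soF; rewrite (hessian_polarE hS hH) ?diag_hessian_E_mx//.
  exact: so_E_mx.
(* Of the two orientations of a pair with negative coefficient, [N] keeps the one along which [beta]
   increases. *)
pose N := [set pq : 'I_n * 'I_n | (beta 0 pq.1 < beta 0 pq.2) &&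
  (alpha 0 (sigma pq.1) < alpha 0 (sigma pq.2))].
have idx : has_index H #|N|.
  apply: (@has_index_diag _ _ (fun p q =>
      (beta 0 p - beta 0 q) * (alpha 0 (sigma q) - alpha 0 (sigma p)))).
  - by move=> p q; rewrite !inE /= mulrB_lt0.
  - by move=> p q; rewrite !inE => /andP[/lt_gtF ->].
  - by move=> E soE; rewrite (hessian_polarE hS hH).
split=> //.
- move=> p q p' q' pq pq' ne; rewrite HE; last exact: so_E_mx.
  rewrite -pair_eqE /= in ne; rewrite E_mxE [(q == q') && _]andbC (negbTE ne).
  (* The remaining coincidence [q = p'], [p = q'] would contradict [p < q] and [p' < q']. *)
  case: andP => [[/eqP qp' /eqP pq'']|_]; last by rewrite subrr mulr0 mul0r.
  by move: pq'; rewrite -qp' -pq'' ltnNge (ltnW pq).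
- move=> p q pq; rewrite HE; last exact: so_E_mx.
  rewrite E_mxE !eqxx/= -val_eqE /= (gtn_eqF pq) subr0 mulr1 !App !Bpp.
  by rewrite mulrA.
- have -> // : #|[pred pq : 'I_n * 'I_n | (B pq.1 pq.1 < B pq.2 pq.2) &&
       (A (sigma pq.2) (sigma pq.2) > A (sigma pq.1) (sigma pq.1))]| = #|N|.
  by apply: eq_card => pq; rewrite !inE !App !Bpp.
rewrite -(inversions_nonzero_count hm hn sigma hS).
(* As [a] and [b] are strictly increasing, comparing diagonal entries amounts to comparing block
   indices. *)
have -> // : [set pq : 'I_n * 'I_n | (blk hn pq.1 < blk hn pq.2)%N &&
   (blk hm (sigma pq.1) < blk hm (sigma pq.2))%N] = N.
by apply/setP => pq; rewrite !inE !mxE a_lt b_lt.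
Qed.
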